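(* Let $k,s,p$ be positive integers with $s\geq 1$ and $k,p\geq 2$. For every real $\epsilon>0$ there exists an integer $n_\epsilon$ such that for all $n\geq n_\epsilon$ the following holds: if $\mathcal{H}\subseteq\binom{[n]}{k}$ satisfies $\nu(\mathcal{H})\leq s$ and $$co_p(\mathcal{H})\geq \left(\frac{s-1}{(k-2)!}+\epsilon\right)n^{k+p-2},$$ then $\mathcal{H}$ is the union of $s$ different trivial intersecting families.
   Context: $[n]=\{1,\dots,n\}$, $\binom{[n]}{k}$ is the family of $k$-subsets of $[n]$, and $\nu(\mathcal{H})$ is the largest number of pairwise disjoint members of $\mathcal{H}$. For $E\subseteq[n]$, $d_{\mathcal{H}}(E)=|\{F\in\mathcal{H}:E\subseteq F\}|$, and $co_p(\mathcal{H})=\sum_{E\in\binom{[n]}{k-1}}(d_{\mathcal{H}}(E))^p$. A family is trivial intersecting if the intersection of all its members is nonempty. ''$\mathcal{H}$ is the union of $s$ different trivial intersecting families'' means $\mathcal{H}=\bigcup_{i=1}^s\mathcal{G}_i$ where each $\mathcal{G}_i$ is a trivial intersecting family with common element $x_i$, the $x_i$ being distinct. *)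

(* Defs.v *)
From mathcomp Require Import all_boot all_order all_algebra.

Set Implicit Arguments.
Unset Strict Implicit.
Unset Printing Implicit Defensive.

Section Families.
Variable T : finType.
Implicit Types (H G : {set {set T}}) (E F : {set T}).

Definition ksubsets (k : nat) : {set {set T}} := [set F : {set T} | #|F| == k].

Definition matching_number H : nat :=
  \max_(M : {set {set T}} | (M \subset H) && trivIset M) #|M|.

Definition family_degree H E : nat := #|[set F in H | E \subset F]|.

(* Here k is the uniformity of H, so the sum runs over the (k-1)-subsets. *)
Definition co_degree_sum (k p : nat) H : nat :=
  \sum_(E in ksubsets (k - 1)) family_degree H E ^ p.

(* Intersections are taken inside the ground set T, so the intersection of
   the empty family is T itself. *)
Definition trivial_intersecting G : Prop := \bigcap_(F in G) F != set0.

(* "Different" refers to the common elements x i being distinct; the families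
   G i need not be disjoint. *)
Definition union_of_trivial_intersecting (s : nat) H : Prop :=
  exists (G : 'I_s -> {set {set T}}) (x : 'I_s -> T),
    [/\ injective x,
        forall i, trivial_intersecting (G i) /\ x i \in \bigcap_(F in G i) F
      & H = \bigcup_(i < s) G i].

End Families.

Arguments ksubsets T k : clear implicits.

(* Main.v *)
(* Call a vertex high if more than k(s+1)n^(k-2) members of H contain it. If
   there are s high vertices, they meet every member of H: a member F missing
   them could be extended greedily, one high vertex at a time, to a matching of
   size s+1. Otherwise the set S of high vertices has at most s-1 elements. The
   (k-1)-sets meeting S number at most (s-1) n^(k-2)/(k-2)! and contribute at
   most n^p each. The members of H avoiding S are covered by a maximal matching,
   hence by at most ks vertices that are not high, so there are O(n^(k-2)) of
   them; as p >= 2, the remaining (k-1)-sets contribute only O(n^(k+p-3)). *)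
Require Import Defs.
From mathcomp Require Import all_boot all_order all_algebra.
From mathcomp Require Import reals.
From mathcomp Require Import zify.

Set Implicit Arguments.
Unset Strict Implicit.
Unset Printing Implicit Defensive.
Import Order.TTheory GRing.Theory Num.Theory.
Local Open Scope ring_scope.
Local Open Scope nat_scope.

(** * Counting the sets that contain or meet a given set *)

Lemma card_ksubsets_supset (T : finType) (k : nat) (A : {set T}) :
  #|[set F in ksubsets T k | A \subset F]| <= 'C(#|T|, k - #|A|).
Proof.
rewrite -(card_draws T (k - #|A|)).
have inj : {in [set F in ksubsets T k | A \subset F] &,
    injective (fun F : {set T} => F :\: A)}.
  move=> F G; rewrite !inE => /andP[_ AF] /andP[_ AG] eFG.
  by rewrite -(setID F A) -(setID G A) (setIidPr AF) (setIidPr AG) eFG.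
rewrite -(card_in_imset inj); apply/subset_leq_card/subsetP.
move=> _ /imsetP[F + ->].
by rewrite !inE => /andP[/eqP <- AF]; rewrite cardsD (setIidPr AF).
Qed.

Lemma family_degree_le_bin (T : finType) (k : nat) (H : {set {set T}})
    (A : {set T}) :
  H \subset ksubsets T k -> family_degree H A <= 'C(#|T|, k - #|A|).
Proof.
move=> sHk; apply: leq_trans (card_ksubsets_supset k A).
by apply/subset_leq_card/subsetP => F; rewrite !in_set => /andP[/(subsetP sHk)];
  rewrite in_set => -> ->.
Qed.

(** The falling factorial has [m] factors, each at most [n]. Keeping [m]! is what yields the exact
    coefficient 1/(k-2)! of the main term; error terms can do without it. *)
Lemma bin_le_expn (n m : nat) : 'C(n, m) * m`! <= n ^ m.
Proof.
rewrite bin_ffact ffact_prod -[m in leqRHS]card_ord -prod_nat_const.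
by apply: leq_prod => i _; apply: leq_subr.
Qed.

Lemma bin_le_expnW (n m : nat) : 'C(n, m) <= n ^ m.
Proof. by apply: leq_trans (bin_le_expn n m); rewrite leq_pmulr ?fact_gt0. Qed.

Lemma card_meeting_le (T : finType) (G : {set {set T}}) (B : {set T}) :
  #|[set F in G | ~~ [disjoint F & B]]|
    <= \sum_(x in B) #|[set F in G | x \in F]|.
Proof.
have sub : [set F in G | ~~ [disjoint F & B]]
    \subset \bigcup_(x in B) [set F in G | x \in F].
  apply/subsetP => F; rewrite inE => /andP[FG /pred0Pn[x /andP[xF xB]]].
  by apply/bigcupP; exists x; rewrite // inE FG.
apply: leq_trans (subset_leq_card sub) _.
elim/big_rec2: _ => [|x m U _ leUm]; first by rewrite cards0.
by apply: leq_trans (leq_card_setU _ _) _; rewrite leq_add2l.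
Qed.

Lemma card_meeting_le_const (T : finType) (G : {set {set T}}) (B : {set T})
    (c : nat) :
  (forall x, x \in B -> #|[set F in G | x \in F]| <= c) ->
  #|[set F in G | ~~ [disjoint F & B]]| <= #|B| * c.
Proof.
move=> le_c; apply: leq_trans (card_meeting_le G B) _.
by rewrite -sum_nat_const; apply: leq_sum.
Qed.

Lemma card_cover_ksubsets (T : finType) (k : nat) (M : {set {set T}}) :
  M \subset ksubsets T k -> #|cover M| <= #|M| * k.
Proof.
move=> sMk; apply: leq_trans (leq_card_cover M) _.
rewrite -sum_nat_const leq_sum // => F /(subsetP sMk).
by rewrite inE => /eqP ->.
Qed.

(** * Greedy extension of matchings, and covers by maximal matchings *)

Lemma leq_matching_number (T : finType) (H M : {set {set T}}) :
  M \subset H -> trivIset M -> #|M| <= matching_number H.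
Proof.
by move=> sMH tM; rewrite /matching_number (leq_bigmax_cond M) // sMH.
Qed.

Lemma trivIset_setU1 (T : finType) (M : {set {set T}}) (F : {set T}) :
  trivIset M -> [disjoint F & cover M] -> trivIset (F |: M).
Proof.
move=> /trivIsetP tM dF.
have dFM G : G \in M -> [disjoint F & G].
  by move=> GM; apply: disjointWr dF; apply: bigcup_sup.
apply/trivIsetP => A B /setU1P[->|AM] /setU1P[->|BM] neAB.
- by rewrite eqxx in neAB.
- exact: dFM.
- by rewrite disjoint_sym dFM.
- exact: tM.
Qed.

(* Greedy step: at most [k * m] vertices are ever to be avoided, and each of
   them lies together with [x] in at most [#|T| ^ (k - 2)] members of [H]. *)
Lemma matching_extension (T : finType) (k m : nat) (H : {set {set T}})
    (xs : seq T) (M : {set {set T}}) :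
  0 < k -> H \subset ksubsets T k -> uniq xs ->
  (forall x, x \in xs -> k * m * #|T| ^ (k - 2) < family_degree H [set x]) ->
  M \subset H -> trivIset M -> (forall x, x \in xs -> x \notin cover M) ->
  #|M| + size xs <= m -> #|M| + size xs <= matching_number H.
Proof.
move=> k0 sHk; elim: xs M => [|x xs IH] M /=.
  by move=> _ _ sMH tM _ _; rewrite addn0 leq_matching_number.
move=> /andP[xxs uxs] deg sMH tM dM lem.
(* The new edge through [x] must also miss the vertices still in [xs], so that they remain uncovered
   for the later steps. *)
pose B := cover M :|: [set y in xs].
have xB : x \notin B by rewrite !inE negb_or dM ?mem_head.
have cardB : #|B| <= k * m.
  apply: leq_trans (leq_card_setU _ _) _.
  apply: (@leq_trans (#|M| * k + size xs * k)).
    rewrite leq_add ?card_cover_ksubsets ?(subset_trans sMH) //.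
    by rewrite cardsE (leq_trans (card_size _)) // leq_pmulr.
  by rewrite -mulnDl mulnC leq_mul2l (leq_trans _ lem) ?orbT // leq_add2l.
have [F FH [xF dFB]] : exists2 F, F \in H & x \in F /\ [disjoint F & B].
  pose G := [set F in H | [set x] \subset F].
  have : #|[set F in G | ~~ [disjoint F & B]]| < #|G|.
    apply: leq_ltn_trans (deg x (mem_head _ _)).
    apply: leq_trans (card_meeting_le_const (c := #|T| ^ (k - 2)) _) _.
      move=> y yB; have neyx : x != y by apply: contraNneq xB => ->.
      have := family_degree_le_bin [set x; y] sHk; rewrite cards2 neyx.
      move=> le_bin; apply: leq_trans (leq_trans le_bin (bin_le_expnW _ _)).
      apply/subset_leq_card/subsetP => F; rewrite !inE sub1set.
      by case/andP=> /andP[-> xF] yF; rewrite subUset !sub1set xF yF.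
    by rewrite leq_mul2r cardB orbT.
  case: (boolP [exists F in G, [disjoint F & B]]) => [/exists_inP[F]|].
    by rewrite inE sub1set => /andP[FH xF] dFB _; exists F.
  rewrite negb_exists_in => /forall_inP noF; rewrite ltnNge => /negP[].
  apply/subset_leq_card/subsetP => F FG; rewrite inE FG; exact: noF.
have dFM : [disjoint F & cover M] by apply: disjointWr dFB; apply: subsetUl.
have FM : F \notin M.
  apply: contra (dM x (mem_head _ _)) => FM.
  by apply/bigcupP; exists F.
have cardFM : #|F |: M| = #|M|.+1 by rewrite cardsU1 FM.
move: lem; rewrite addnS -addSn -cardFM => lem; apply: IH => //.
- by move=> y yxs; apply: deg; rewrite inE yxs orbT.
- by rewrite subUset sub1set FH.
- exact: trivIset_setU1.
- move=> y yxs; rewrite /cover bigcup_setU big_set1 inE negb_or.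
  rewrite dM ?inE ?yxs ?orbT // andbT.
  apply: contraTN dFB => yF; apply/pred0Pn; exists y.
  by rewrite /= yF !inE yxs orbT.
Qed.

(** A member [F] missing [X] would start a matching [[set F]] that extends greedily, one edge per
    vertex of [X], to size [#|X|.+1]. *)
Lemma high_degree_transversal (T : finType) (k : nat) (H : {set {set T}})
    (X : {set T}) :
  0 < k -> H \subset ksubsets T k -> matching_number H <= #|X| ->
  (forall x, x \in X ->
     k * #|X|.+1 * #|T| ^ (k - 2) < family_degree H [set x]) ->
  forall F, F \in H -> ~~ [disjoint F & X].
Proof.
move=> k0 sHk leX deg F FH; apply/negP => dFX.
have: #|[set F]| + size (enum X) <= matching_number H.
  apply: (@matching_extension T k #|X|.+1) => //.
  - exact: enum_uniq.
  - by move=> x; rewrite mem_enum; apply: deg.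
  - by rewrite sub1set.
  - by apply/trivIsetP => A B /set1P-> /set1P->; rewrite eqxx.
  - move=> x; rewrite mem_enum /cover big_set1 => xX.
    apply: contraTN dFX => xF; apply/pred0Pn; exists x.
    by rewrite /= xF xX.
  - by rewrite cards1 -cardE.
by rewrite cards1 -cardE add1n ltnNge leX.
Qed.

(** By maximality, the vertices of an inclusion-maximal matching meet every member, and there are at
    most [matching_number H * k] of them. *)
Lemma card_le_matching_number (T : finType) (k c : nat) (H : {set {set T}}) :
  0 < k -> H \subset ksubsets T k ->
  (forall x, x \in cover H -> #|[set F in H | x \in F]| <= c) ->
  #|H| <= matching_number H * k * c.
Proof.
move=> k0 sHk deg.
pose P (M : {set {set T}}) := (M \subset H) && trivIset M.
have P0 : P set0.
  by rewrite /P sub0set; apply/trivIsetP => A B; rewrite inE.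
have [M /maxsetP[/andP[sMH tM] maxM] _] := maxset_exists P0.
have meets F : F \in H -> ~~ [disjoint F & cover M].
  move=> FH; apply/negP => dFM.
  have FM : F \in M.
    rewrite -(maxM (F |: M)) ?setU11 ?subsetUr //.
    by rewrite /P subUset sub1set FH sMH trivIset_setU1.
  (* [F] is part of [cover M] and disjoint from it, hence empty, which [0 < k] excludes. *)
  have /eqP F0 : F == set0.
    rewrite -[F]setIid setI_eq0; apply: disjointWr dFM; exact: bigcup_sup.
  by move/subsetP/(_ _ FH): sHk; rewrite inE F0 cards0; case: k k0.
have HE : [set F in H | ~~ [disjoint F & cover M]] = H.
  by apply/setP=> F; rewrite inE; case: (boolP (F \in H)) => // /meets ->.
rewrite -[in leqLHS]HE.
apply: leq_trans (card_meeting_le_const (c := c) _) _.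
  move=> x /bigcupP[F FM xF]; apply: deg; apply/bigcupP; exists F => //.
  exact: (subsetP sMH).
rewrite leq_mul2r; apply/orP; right.
apply: leq_trans (card_cover_ksubsets (subset_trans sMH sHk)) _.
by rewrite leq_mul2r leq_matching_number ?orbT.
Qed.

(** * Upper bounds for the co-degree sum *)

(** Double counting: each member has exactly [k] subsets of size [k - 1]. *)
Lemma sum_family_degree (T : finType) (k : nat) (H : {set {set T}}) :
  0 < k -> H \subset ksubsets T k ->
  \sum_(E in ksubsets T (k - 1)) family_degree H E = #|H| * k.
Proof.
move=> k0 sHk.
under eq_bigr do rewrite /family_degree -sum1dep_card.
rewrite (exchange_big_dep (mem H)) => [|E F _ /andP[]//] /=.
rewrite -sum_nat_const; apply: eq_bigr => F FH.
rewrite sum1dep_card.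
have /eqP kF : #|F| == k by move/subsetP/(_ _ FH): sHk; rewrite inE.
have := cards_draws F (k - 1); rewrite kF bin_sub // bin1 => {2}<-.
by apply: eq_card => E; rewrite !inE FH andbC.
Qed.

(** The error is made linear in [d], so that summing it over the (k-1)-sets only requires the plain
    sum of degrees. *)
Lemma expn_addn_le (a d p N : nat) :
  0 < p -> d <= N -> (a + d) ^ p <= a ^ p + a.+1 ^ p * (N ^ p.-1 * d).
Proof.
(* For positive [d], [a + d] is at most [a.+1 * d]; the term [a ^ p] is only needed at [d = 0]. *)
move=> p0; case: d => [|d] dN; first by rewrite muln0 muln0 !addn0.
apply: leq_trans (leq_addl _ _).
apply: (@leq_trans ((a.+1 * d.+1) ^ p)).
  by rewrite leq_exp2r // mulSn addnC leq_add2l leq_pmulr.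
rewrite expnMn leq_mul2l; apply/orP; right.
rewrite -{1}(prednK p0) expnSr leq_mul2r.
by case: p.-1 => // e; rewrite leq_exp2r.
Qed.

(* The [E] meeting [S] are few, and have degree at most [#|T|]; any other [E] has
   degree at most [#|S|] plus its degree among the members avoiding [S]. *)
Lemma co_degree_sum_le (T : finType) (k p : nat) (H : {set {set T}})
    (S : {set T}) :
  2 <= k -> 0 < p -> H \subset ksubsets T k ->
  co_degree_sum k p H <=
    #|S| * 'C(#|T|, k - 2) * #|T| ^ p + (#|S| ^ p * 'C(#|T|, k - 1) +
    #|S|.+1 ^ p * (#|T| ^ p.-1 * (#|[set F in H | [disjoint F & S]]| * k))).
Proof.
move=> k2 p0 sHk; have k0 : 0 < k by apply: ltnW.
set G := [set F in H | _].
have sGk : G \subset ksubsets T k.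
  by apply: subset_trans sHk; apply/subsetP => F; rewrite inE => /andP[].
have degT (K : {set {set T}}) (E : {set T}) : K \subset ksubsets T k ->
    E \in ksubsets T (k - 1) -> family_degree K E <= #|T|.
  move=> sK; rewrite inE => /eqP cE.
  by have := family_degree_le_bin E sK; rewrite cE subKn // bin1.
rewrite /co_degree_sum (bigID (fun E : {set T} => ~~ [disjoint E & S])) /=.
apply: leq_add.
  apply: (@leq_trans (#|[set E in ksubsets T (k - 1) | ~~ [disjoint E & S]]|
      * #|T| ^ p)).
    rewrite -sum1dep_card big_distrl /= leq_sum // => E /andP[Ek _].
    by rewrite mul1n leq_exp2r // degT.
  rewrite leq_mul2r; apply/orP; right; apply: card_meeting_le_const => x _.
  have := card_ksubsets_supset (k - 1) [set x]; rewrite cards1 -subnDA.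
  congr (_ <= _); apply: eq_card => E.
  by rewrite !inE sub1set.
(* Once bounded, the sum over the sets missing [S] is enlarged to all (k-1)-sets. *)
apply: (@leq_trans (\sum_(E in ksubsets T (k - 1))
    (#|S| ^ p + #|S|.+1 ^ p * (#|T| ^ p.-1 * family_degree G E)))).
  rewrite big_mkcondr /= leq_sum // => E Ek.
  rewrite negbK; case: ifP => // dES.
  apply: leq_trans (expn_addn_le _ p0 (degT _ _ sGk Ek)).
  rewrite leq_exp2r //.
  pose HE := [set F in H | E \subset F].
  rewrite /family_degree -/HE.
  have sub : HE \subset [set F in HE | ~~ [disjoint F & S]]
      :|: [set F in G | E \subset F].
    apply/subsetP => F; rewrite !inE => /andP[-> ->] /=.
    by rewrite andbT orNb.
  apply: leq_trans (subset_leq_card sub) _.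
  apply: leq_trans (leq_card_setU _ _) _; rewrite leq_add2r.
  (* For [x] in [S], hence outside [E], the only possible member containing both is [x |: E]; each
     [x] thus contributes at most 1. *)
  rewrite -[leqRHS]muln1; apply: card_meeting_le_const => x xS.
  have xE : x \notin E.
    by apply: contraTN dES => xE; apply/pred0Pn; exists x; rewrite /= xE.
  have := family_degree_le_bin (x |: E) sHk.
  move: Ek; rewrite inE => /eqP cE.
  rewrite cardsU1 xE cE subnKC // subnn bin0; apply: leq_trans.
  apply/subset_leq_card/subsetP => F; rewrite !inE.
  by case/andP=> /andP[-> EF] xF; rewrite subUset sub1set xF EF.
rewrite big_split /= sum_nat_const card_draws mulnC leq_add2l.
by rewrite -!big_distrr /= sum_family_degree.
Qed.

Lemma co_degree_sum_le_of_low_degree (T : finType) (k p s t : nat)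
    (H : {set {set T}}) (S : {set T}) :
  2 <= k -> 2 <= p -> 0 < #|T| -> H \subset ksubsets T k ->
  matching_number H <= s -> #|S| <= t ->
  (forall x, x \notin S ->
     family_degree H [set x] <= k * s.+1 * #|T| ^ (k - 2)) ->
  co_degree_sum k p H <=
    t * 'C(#|T|, k - 2) * #|T| ^ p +
    (t ^ p + t.+1 ^ p * (s * k * (k * s.+1) * k)) * #|T| ^ (k + p - 3).
Proof.
move=> k2 p2 n0 sHk leH leS low.
have k0 : 0 < k by apply: ltnW.
have p0 : 0 < p by apply: ltnW.
apply: leq_trans (co_degree_sum_le S k2 p0 sHk) _.
set G := [set F in H | _].
have sGH : G \subset H by apply/subsetP => F; rewrite inE => /andP[].
have leG : #|G| <= s * k * (k * s.+1 * #|T| ^ (k - 2)).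
  have muG : matching_number G <= s.
    apply: leq_trans leH; apply/bigmax_leqP => M /andP[sMG tM].
    by rewrite leq_matching_number // (subset_trans sMG).
  apply: leq_trans (card_le_matching_number
    (c := k * s.+1 * #|T| ^ (k - 2)) k0 (subset_trans sGH sHk) _) _.
    move=> x /bigcupP[F]; rewrite inE => /andP[_ dF] xF.
    have xS : x \notin S.
      by apply: contraTN dF => xS; apply/pred0Pn; exists x; rewrite /= xF.
    apply: leq_trans (low x xS); apply/subset_leq_card/subsetP => A.
    by rewrite !inE sub1set => /andP[/andP[-> _] ->].
  by rewrite !leq_mul2r muG !orbT.
apply: leq_add; first by rewrite !leq_mul2r leS !orbT.
rewrite mulnDl leq_add //.
  rewrite leq_mul ?leq_exp2r //; apply: leq_trans (bin_le_expnW _ _) _.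
  (* Here [p >= 2] gives [k - 1 <= k + p - 3]. *)
  rewrite leq_pexp2l //; lia.
rewrite -mulnA leq_mul ?leq_exp2r //.
apply: (@leq_trans (#|T| ^ p.-1 * (s * k * (k * s.+1 * #|T| ^ (k - 2)) * k))).
  by rewrite leq_mul2l leq_mul2r leG !orbT.
have -> : k + p - 3 = p.-1 + (k - 2) by lia.
rewrite expnD; nia.
Qed.

(** * From transversals to the theorem *)

(** The families are the stars of [H] at the points of [X]. An empty star is harmless, since its
    intersection is all of [T]. *)
Lemma union_of_trivial_intersecting_transversal (T : finType)
    (H : {set {set T}}) (X : {set T}) :
  (forall F, F \in H -> ~~ [disjoint F & X]) ->
  union_of_trivial_intersecting #|X| H.
Proof.
move=> HX; exists (fun i => [set F in H | enum_val i \in F]), enum_val.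
have mem_star i : @enum_val _ (mem X) i
    \in \bigcap_(F in [set F in H | enum_val i \in F]) F.
  by apply/bigcapP => F; rewrite inE => /andP[].
split; first exact: enum_val_inj.
  by move=> i; split=> //; apply/set0Pn; exists (enum_val i).
apply/setP => F; apply/idP/bigcupP => [FH|[i _]]; last by rewrite inE => /andP[].
have /pred0Pn[x /andP[/= xF xX]] := HX F FH.
by exists (enum_rank_in xX x); rewrite // inE FH enum_rankK_in.
Qed.

Local Close Scope nat_scope.

Theorem theorem2p2 (R : realType) (k s p : nat)
    (hs : (1 <= s)%N) (hk : (2 <= k)%N) (hp : (2 <= p)%N)
    (eps : R) (heps : 0 < eps) :
  exists n_eps : nat, forall n : nat, (n_eps <= n)%N ->
    forall H : {set {set 'I_n}},
      H \subset ksubsets 'I_n k ->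
      (matching_number H <= s)%N ->
      ((s%:R - 1) / ((k - 2)`!)%:R + eps) * n%:R ^+ (k + p - 2)
        <= (co_degree_sum k p H)%:R ->
      union_of_trivial_intersecting s H.
Proof.
(* The error constant for a set of at most [t = s.-1] high vertices, with [t.+1] written as [s]. *)
pose K := (s.-1 ^ p + s ^ p * (s * k * (k * s.+1) * k))%N.
exists (Num.bound (K%:R / eps)%R).+1%N => n len H sHk leH le_co.
have n0 : (0 < n)%N by apply: leq_trans len.
pose S := [set x | k * s.+1 * n ^ (k - 2) < family_degree H [set x]]%N.
have [leS|ltS] := leqP s #|S|%N.
  (* Exactly [s] high vertices are kept: their number fixes both the number of families and the
     degree threshold. *)
  have [X sXS cX] : exists2 X : {set 'I_n}, X \subset S & #|X|%N = s.
    have := cards_draws S s; have := leS; rewrite -bin_gt0 => + eqd.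
    rewrite -eqd card_gt0 => /set0Pn[X]; rewrite inE => /andP[sX /eqP].
    by exists X.
  rewrite -cX; apply: union_of_trivial_intersecting_transversal.
  apply: (high_degree_transversal (k := k)); rewrite ?cX ?card_ord //.
    exact: ltnW.
  by move=> x /(subsetP sXS); rewrite inE.
exfalso; move: le_co; apply/negP; rewrite -ltNge.
have low x : x \notin S ->
    (family_degree H [set x] <= k * s.+1 * #|'I_n| ^ (k - 2))%N.
  by rewrite inE -leqNgt card_ord.
have leS : (#|S| <= s.-1)%N by rewrite -ltnS prednK.
have := co_degree_sum_le_of_low_degree hk hp _ sHk leH leS low.
rewrite card_ord prednK // -/K => /(_ n0).
rewrite -(ler_nat R) natrD => /le_lt_trans; apply.
rewrite mulrDl ler_ltD //.
  rewrite !natrM -subn1 natrB // -!mulrA ler_wpM2l ?subr_ge0 ?ler1n //.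
  have -> : (k + p - 2 = (k - 2) + p)%N by lia.
  rewrite exprD mulrA natrX ler_wpM2r ?exprn_ge0 //.
  (* The main term reduces to 'C(n, k - 2) (k - 2)! <= n ^ (k - 2). *)
  rewrite ler_pdivlMl ?ltr0n ?fact_gt0 // mulrC -natrM -natrX ler_nat.
  exact: bin_le_expn.
have -> : (k + p - 2 = (k + p - 3).+1)%N by lia.
(* Cancelling n ^ (k + p - 3) leaves [K < eps * n], which the choice of the threshold ensures. *)
rewrite natrM natrX exprS mulrA ltr_pM2r ?exprn_gt0 ?ltr0n //.
rewrite mulrC -ltr_pdivrMr //.
apply: (@lt_trans _ _ (Num.bound (K%:R / eps))%:R).
  by apply: archi_boundP; rewrite divr_ge0 ?ler0n ?ltW.
by rewrite ltr_nat.
Qed.
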